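(* Let $p\ge2$ and $k\ge1$. The natural inclusion $i:F(p^k)\to F(p)$ is a quasi-isometric embedding with respect to the word metrics of $F(p^k)$ and $F(p)$.
   Context: For $q\ge2$, $F(q)$ is the group of piecewise-linear orientation-preserving homeomorphisms of $[0,1]$ with breakpoints in $\mathbb{Z}[1/q]$ and slopes integer powers of $q$; it is generated by the finite set $x_0,\dots,x_{q-1}$ from the presentation $\langle x_0,x_1,\dots\mid x_i^{-1}x_jx_i=x_{j+q-1}\ (i<j)\rangle$, and its word metric is taken with respect to these generators. Since $\mathbb{Z}[1/p^k]=\mathbb{Z}[1/p]$ and powers of $p^k$ are powers of $p$, $F(p^k)$ is a subgroup of $F(p)$; $i$ is this inclusion. A map $f$ between metric spaces is a quasi-isometric embedding if there are constants $C\ge1$, $K\ge0$ with $\frac1C d(a,b)-K\le d(f(a),f(b))\le C d(a,b)+K$ for all $a,b$. *)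

(* Defs.v *)
(* Thompson-like groups F(q) modelled as PL maps on the
   rational points of [0,1]. *)
From mathcomp Require Import all_boot all_order all_algebra.
Set Implicit Arguments. Unset Strict Implicit. Unset Printing Implicit Defensive.
Import Order.TTheory GRing.Theory Num.Theory.
Local Open Scope ring_scope.

Definition inZq (q : nat) (x : rat) : Prop :=
  exists (m : int) (n : nat), x = m%:~R / (q ^ n)%:R.

Definition powq (q : nat) (s : rat) : Prop :=
  exists z : int, s = (q%:R : rat) ^ z.

(* f : rat -> rat (considered on [0,1] only) is an element of F(q):
   there is a subdivision 0 = a_0 < ... < a_n = 1 with all a_i in Z[1/q],
   images b_i, such that f is affine on each [a_i, a_{i+1}] from b_i to
   b_{i+1}, with slope an integer power of q, and b_0 = 0, b_n = 1. *)
Definition isF (q : nat) (f : rat -> rat) : Prop :=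
  exists (a b : seq rat),
    [/\ size a = size b /\ (1 < size a)%N,
        (head 0 a = 0 /\ last 0 a = 1) /\ (head 0 b = 0 /\ last 0 b = 1),
        forall i, (i < size a)%N -> inZq q (nth 0 a i) &
        forall i, (i.+1 < size a)%N ->
          let a0 := nth 0 a i in let a1 := nth 0 a i.+1 in
          let b0 := nth 0 b i in let b1 := nth 0 b i.+1 in
          [/\ a0 < a1, powq q ((b1 - b0) / (a1 - a0)) &
              forall x, a0 <= x <= a1 -> f x = b0 + (b1 - b0) / (a1 - a0) * (x - a0)]].

Fixpoint pl_eval (pts : seq (rat * rat)) (x : rat) : rat :=
  match pts with
  | (a0, b0) :: (((a1, b1) :: _) as rest) =>
      if (a0 <= x) && (x <= a1) then b0 + (b1 - b0) / (a1 - a0) * (x - a0)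
      else pl_eval rest x
  | _ => x
  end.

Definition qfrac (q : nat) (i : nat) : rat := i%:R / q%:R.

Definition dom0 (q : nat) : seq rat :=
  [seq qfrac q i | i <- iota 0 q] ++
  [seq qfrac q (q - 1) + qfrac (q * q) t | t <- iota 1 q].
Definition rng (q j : nat) : seq rat :=
  [seq qfrac q i | i <- iota 0 j.+1] ++
  [seq qfrac q j + qfrac (q * q) t | t <- iota 1 q] ++
  [seq qfrac q i | i <- iota j.+2 (q - j.+1)].

Definition shiftq (q : nat) (l : seq rat) : seq rat :=
  [seq qfrac q (q - 1) + d / q%:R | d <- l].

(* (domain breakpoints, range breakpoints) of the generator x_j, j < q:
   for j <= q-2, x_j is the map with domain subdivision
   0,1/q,...,(q-1)/q, then (q-1)/q + t/q^2 (t=1..q), and range subdivision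
   0,...,j/q, then j/q + t/q^2 (t=1..q), then (j+2)/q,...,1;
   x_{q-1} is x_0 rescaled onto [(q-1)/q,1] and the identity on [0,(q-1)/q]. *)
Definition gen_pts (q j : nat) : seq rat * seq rat :=
  if j == q.-1 then
    let ids := [seq qfrac q i | i <- iota 0 q.-1] in
    (ids ++ shiftq q (dom0 q), ids ++ shiftq q (rng q 0))
  else (dom0 q, rng q j).

Definition gen (q j : nat) : rat -> rat :=
  pl_eval (zip (gen_pts q j).1 (gen_pts q j).2).
Definition gen_inv (q j : nat) : rat -> rat :=
  pl_eval (zip (gen_pts q j).2 (gen_pts q j).1).

Definition letter (q : nat) (l : nat * bool) : rat -> rat :=
  if l.2 then gen_inv q l.1 else gen q l.1.
Definition evalw (q : nat) (w : seq (nat * bool)) : rat -> rat :=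
  foldr (fun l h => letter q l \o h) id w.

(* word distance in F(q) between f and g is at most n:
   g = f . w on [0,1] for some word w in x_0^{+-1},...,x_{q-1}^{+-1}
   of length <= n, i.e. |f^-1 g| <= n *)
Definition wdist_le (q : nat) (f g : rat -> rat) (n : nat) : Prop :=
  exists w : seq (nat * bool),
    [/\ (size w <= n)%N, all (fun l => (l.1 < q)%N) w &
        forall x, 0 <= x <= 1 -> g x = f (evalw q w x)].

(* Main.v *)
Require Import Defs.
From mathcomp Require Import all_boot all_order all_algebra.
From mathcomp Require Import zify ring lra.

(* The word length in F(q) is equivalent to the number of leaves of a pair of
   q-ary trees representing an element.  A generator is represented by a pair
   of at most 3q leaves, and composing two tree pairs only requires a common
   expansion, so a word of length n has a tree pair with O(n) leaves.
   Conversely a tree is read as the list of subtrees hanging off its right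
   spine; the generator x_j merges the trees in positions j, ..., j + q - 1
   of that list, and a left comb kept at position 0 gives access to all other
   positions, so a tree with N leaves is brought to a normal form depending
   only on N by O(N) generators.
   A p^k-ary tree is a p-ary tree.  Conversely, if a p-ary tree pair
   represents an element whose slopes are powers of p^k, corresponding leaves
   have depths congruent modulo k; expanding each leaf by a full tree of
   height at most k makes all depths multiples of k, at the cost of a factor
   p^k, and such p-ary trees are p^k-ary trees. *)

Set Implicit Arguments. Unset Strict Implicit. Unset Printing Implicit Defensive.
Import Order.TTheory GRing.Theory Num.Theory.
Local Open Scope ring_scope.

(** * Trees and partitions *)

(* (a, l) stands for the interval [a, a + l]. *)
Notation ival := (rat * rat)%type.

Definition unit_ival : ival := (0, 1).

Definition child (q : nat) (I : ival) (i : nat) : ival :=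
  (I.1 + I.2 * (i%:R / q%:R), I.2 / q%:R).
Definition children (q : nat) (I : ival) : seq ival := mkseq (child q I) q.

(* Only the first q children of a node count in a q-ary tree, so that the same
   type serves all arities. *)
Inductive tree : Type := Leaf | Node of nat -> tree.

Fixpoint leaves (q : nat) (t : tree) (I : ival) : seq ival :=
  if t is Node c then flatten (mkseq (fun i => leaves q (c i) (child q I i)) q)
  else [:: I].

Fixpoint nleaves (q : nat) (t : tree) : nat :=
  if t is Node c then sumn (mkseq (fun i => nleaves q (c i)) q) else 1%N.

Definition refine (q : nat) (L : seq tree) (P : seq ival) : seq ival :=
  flatten [seq leaves q x.1 x.2 | x <- zip L P].

Definition nleavess (q : nat) (L : seq tree) : nat := sumn (map (nleaves q) L).

Definition treepart (q : nat) (P : seq ival) : Prop :=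
  exists t, leaves q t unit_ival = P.

Lemma size_leaves q t I : size (leaves q t I) = nleaves q t.
Proof.
elim: t I => [//|c IH] I /=.
rewrite size_flatten /shape /mkseq -map_comp; congr sumn.
by apply: eq_map => i /=.
Qed.

Lemma refine_cat q L1 L2 P1 P2 : size L1 = size P1 ->
  refine q (L1 ++ L2) (P1 ++ P2) = refine q L1 P1 ++ refine q L2 P2.
Proof. by move=> h; rewrite /refine zip_cat // map_cat flatten_cat. Qed.

Lemma refine_cons q t L I P :
  refine q (t :: L) (I :: P) = leaves q t I ++ refine q L P.
Proof. by []. Qed.

Lemma refine1 q t I : refine q [:: t] [:: I] = leaves q t I.
Proof. by rewrite /refine /= cats0. Qed.

Lemma refine_map (S : Type) q (c : S -> tree) (F : S -> ival) s :
  refine q (map c s) (map F s) = flatten [seq leaves q (c i) (F i) | i <- s].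
Proof. by elim: s => //= i s IH; rewrite refine_cons IH. Qed.

Lemma leaves_Node q c I :
  leaves q (Node c) I = refine q (mkseq c q) (children q I).
Proof. by rewrite /mkseq refine_map. Qed.

Lemma refine_nseq q P n : (size P <= n)%N -> refine q (nseq n Leaf) P = P.
Proof.
elim: P n => [|I P IH] [|n] //= h.
by rewrite refine_cons IH.
Qed.

Lemma size_refine q L P : size L = size P ->
  size (refine q L P) = nleavess q L.
Proof.
elim: L P => [|t L IH] [|I P] //= [h].
by rewrite refine_cons size_cat size_leaves IH.
Qed.

(** Moves one caret from the trees hung on a subdivision to the subdivision itself; every generator
    move rests on this exchange. *)
Lemma leaves_split q I L P c : (size L < size P)%N -> forall L',
  refine q (L ++ Node c :: L') P =
  refine q (L ++ mkseq c q ++ L')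
    (take (size L) P ++ children q (nth I P (size L)) ++ drop (size L).+1 P).
Proof.
move=> h L'.
have hs : size L = size (take (size L) P) by rewrite size_takel // ltnW.
rewrite -{1}[P](cat_take_drop (size L)) (drop_nth I) // !refine_cat //;
  last by rewrite !size_mkseq.
by rewrite refine_cons leaves_Node.
Qed.

(** The trees of [L] are dealt out from left to right, each child of [t] taking as many as it has
    leaves. The new tree is independent of [I], so one tree serves domain and range alike. *)
Lemma graft q t L : size L = nleaves q t ->
  exists t', forall I, leaves q t' I = refine q L (leaves q t I).
Proof.
elim: t L => [|c IH] L.
  case: L => [|u [|]] //= _; exists u => I; by rewrite refine1.
move=> hL.
have H : forall s L, size L = sumn [seq nleaves q (c i) | i <- s] ->
  exists cs, size cs = size s /\ forall Is, size Is = size s ->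
    refine q cs Is = refine q L (refine q (map c s) Is).
  elim=> [|i s IHs] {hL}L /=.
    case: L => // _; exists [::]; split=> // -[] //.
  move=> hL.
  have h1 : size (take (nleaves q (c i)) L) = nleaves q (c i).
    by rewrite size_takel // hL leq_addr.
  have [t' ht'] := IH i _ h1.
  have [|cs [hcs Hcs]] := IHs (drop (nleaves q (c i)) L).
    by rewrite size_drop hL addKn.
  exists (t' :: cs); split=> [|[//|I Is] [hI]]; first by rewrite /= hcs.
  rewrite !refine_cons ht' Hcs // -{3}[L](cat_take_drop (nleaves q (c i))).
  by rewrite refine_cat // size_leaves.
have [cs [hcs Hcs]] := H _ _ hL.
rewrite size_iota in hcs.
exists (Node (nth Leaf cs)) => I.
rewrite !leaves_Node -hcs mkseq_nth hcs Hcs //.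
by rewrite size_mkseq size_iota.
Qed.

Lemma treepart_refine q L P : treepart q P -> size L = size P ->
  treepart q (refine q L P).
Proof.
case=> t <- h; rewrite size_leaves in h.
have [t' ht'] := graft h.
by exists t'; rewrite ht'.
Qed.

(** The union of the two trees is a common expansion. Where one tree stops, the other continues
    unchanged, so every leaf of the union is a leaf of [t] or of [u]; hence the additive bound. *)
Lemma join q t u : (0 < q)%N -> exists L M,
  [/\ size L = nleaves q t, size M = nleaves q u,
      forall I, refine q L (leaves q t I) = refine q M (leaves q u I) &
      (nleavess q L <= nleaves q t + nleaves q u)%N].
Proof.
move=> q0; elim: t u => [|c IH] u.
  exists [:: u], (nseq (nleaves q u) Leaf); split=> //.
  - by rewrite size_nseq.
  - by move=> I; rewrite refine1 refine_nseq // size_leaves.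
  - by rewrite /nleavess /= addn0 leq_addl.
case: u => [|d].
  exists (nseq (nleaves q (Node c)) Leaf), [:: Node c]; split=> //.
  - by rewrite size_nseq.
  - by move=> I; rewrite refine1 refine_nseq // size_leaves.
  - by rewrite /nleavess map_nseq sumn_nseq mul1n leq_addr.
have H : forall s, exists L M,
  [/\ size L = nleavess q (map c s), size M = nleavess q (map d s),
      forall Is, size Is = size s ->
        refine q L (refine q (map c s) Is) = refine q M (refine q (map d s) Is) &
      (nleavess q L <= nleavess q (map c s) + nleavess q (map d s))%N].
  elim=> [|i s [L [M [hL hM HI Hs]]]].
    by exists [::], [::]; split.
  have [L' [M' [hL' hM' HI' Hs']]] := IH i (d i).
  exists (L' ++ L), (M' ++ M); split.
  - by rewrite size_cat hL hL'.
  - by rewrite size_cat hM hM'.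
  - case=> [//|I Is] [hI].
    by rewrite !refine_cons !refine_cat ?size_leaves // HI' HI.
  - move: Hs Hs'; rewrite /nleavess map_cat sumn_cat /=; lia.
have [L [M [hL hM HI Hs]]] := H (iota 0 q).
exists L, M; split=> //=.
- by rewrite hL /nleavess -map_comp.
- by rewrite hM /nleavess -map_comp.
- by move=> I; rewrite -/(leaves q (Node c) I) -/(leaves q (Node d) I) !leaves_Node HI // size_mkseq size_iota.
- by move: Hs; rewrite /nleavess -!map_comp.
Qed.

(** * Piecewise affine maps *)

(** Both intervals are parametrised by [0, 1], which keeps the slope J.2 / I.2 implicit and makes
    composition of pieces free of division. *)
Definition affine (f : rat -> rat) (I J : ival) : Prop :=
  forall t, 0 <= t <= 1 -> f (I.1 + I.2 * t) = J.1 + J.2 * t.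

Fixpoint pwaffine (f : rat -> rat) (P Q : seq ival) : Prop :=
  match P, Q with
  | [::], [::] => True
  | X :: P', Y :: Q' => affine f X Y /\ pwaffine f P' Q'
  | _, _ => False
  end.

Lemma pwaffine_size f P Q : pwaffine f P Q -> size P = size Q.
Proof. by elim: P Q => [|I P IH] [|J Q] //= [_ /IH ->]. Qed.

Lemma pwaffine_cat f P P' Q Q' : pwaffine f P Q -> pwaffine f P' Q' ->
  pwaffine f (P ++ P') (Q ++ Q').
Proof.
elim: P Q => [|I P IH] [|J Q] //= [h hP] h'; split=> //; exact: IH.
Qed.

Lemma pwaffine_catE f P P' Q Q' : size P = size Q ->
  pwaffine f (P ++ P') (Q ++ Q') -> pwaffine f P Q /\ pwaffine f P' Q'.
Proof.
elim: P Q => [|I P IH] [|J Q] //= [hs] [h /(IH _ hs) [hP hP']].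
by split.
Qed.

Lemma pwaffine_comp f g P Q R : pwaffine f P Q -> pwaffine g Q R ->
  pwaffine (g \o f) P R.
Proof.
elim: P Q R => [|I P IH] [|J Q] [|K R] //= [h hP] [h' hQ]; split.
  by move=> t ht /=; rewrite h // h'.
exact: IH hP hQ.
Qed.

Lemma affine_child f q I J i : affine f I J -> (i < q)%N ->
  affine f (child q I i) (child q J i).
Proof.
move=> h iq t /andP [t0 t1] /=.
have q0 : 0 < q%:R :> rat by rewrite ltr0n; lia.
have E (K : ival) : K.1 + K.2 * (i%:R / q%:R) + K.2 / q%:R * t =
  K.1 + K.2 * ((i%:R + t) / q%:R) by field; rewrite gt_eqF.
rewrite !E h // divr_ge0 ?addr_ge0 ?ler0n //= ler_pdivrMr // mul1r.
have : (i%:R + 1 <= q%:R :> rat) by rewrite natr1 ler_nat.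
by move: t1; lra.
Qed.

Lemma pwaffine_leaves f q t I J : affine f I J ->
  pwaffine f (leaves q t I) (leaves q t J).
Proof.
elim: t I J => [|c IH] I J h /=; first by [].
have H : forall s, (forall i, i \in s -> (i < q)%N) ->
  pwaffine f (flatten [seq leaves q (c i) (child q I i) | i <- s])
             (flatten [seq leaves q (c i) (child q J i) | i <- s]).
  elim=> [//|i s IHs] hs /=; apply: pwaffine_cat.
    by apply: IH; apply: affine_child => //; apply: hs; rewrite mem_head.
  by apply: IHs => j js; apply: hs; rewrite inE js orbT.
by apply: H => i; rewrite mem_iota.
Qed.

Lemma pwaffine_refine f q L P Q : size L = size P -> pwaffine f P Q ->
  pwaffine f (refine q L P) (refine q L Q).
Proof.
elim: L P Q => [|t L IH] [|I P] [|J Q] //= [hs] [h hP].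
rewrite !refine_cons; apply: pwaffine_cat; first exact: pwaffine_leaves.
exact: IH.
Qed.

(** * Consecutive intervals and breakpoint lists *)

Fixpoint chain (a : rat) (P : seq ival) (b : rat) : Prop :=
  if P is X :: P' then [/\ X.1 = a, 0 < X.2 & chain (a + X.2) P' b]
  else a = b.

Lemma chain_cat a b c P Q : chain a P b -> chain b Q c -> chain a (P ++ Q) c.
Proof.
elim: P a => [|I P IH] a /=; first by move=> ->.
by move=> [-> h hP] hQ; split=> //; exact: IH.
Qed.

Lemma chain_leaves q t I : (0 < q)%N -> 0 < I.2 ->
  chain I.1 (leaves q t I) (I.1 + I.2).
Proof.
move=> q0; elim: t I => [|c IH] I I0 /=; first by split.
have q0' : 0 < q%:R :> rat by rewrite ltr0n.
have H : forall m n, chain (I.1 + I.2 * (n%:R / q%:R))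
    (flatten [seq leaves q (c i) (child q I i) | i <- iota n m])
    (I.1 + I.2 * ((n + m)%N%:R / q%:R)).
  elim=> [|m IHm] n /=; first by rewrite addn0.
  apply: chain_cat (IH n _ _) _; first by rewrite /= divr_gt0.
  rewrite addnS -addSn.
  have -> : (child q I n).1 + (child q I n).2 = I.1 + I.2 * (n.+1%:R / q%:R).
    by rewrite /child /= -natr1; field; rewrite gt_eqF.
  exact: IHm.
have := H q 0%N; rewrite mul0r mulr0 addr0 add0n divff ?gt_eqF //.
by rewrite mulr1.
Qed.

Lemma chain_treepart q P : (0 < q)%N -> treepart q P -> chain 0 P 1.
Proof.
move=> q0 [t <-]; have := @chain_leaves q t unit_ival q0 ltr01.
by rewrite add0r.
Qed.

Lemma chain_le a P b : chain a P b -> a <= b.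
Proof.
elim: P a => [|I P IH] a /=; first by move=> ->.
move=> [_ h /IH]; lra.
Qed.

Lemma chain_bounds a P b I : chain a P b -> I \in P ->
  [/\ a <= I.1, 0 < I.2 & I.1 + I.2 <= b].
Proof.
elim: P a => [|J P IH] a //= [hJ hJ0 hP]; rewrite inE => /orP [/eqP ->|hI].
  have := chain_le hP; rewrite hJ; split=> //; lra.
have [h1 h2 h3] := IH _ hP hI; split=> //; lra.
Qed.

(** The pieces cover [a, b]. An empty list would force a = b and say nothing about that one point,
    hence the nonemptiness. *)
Lemma pwaffine_unique f g a b P Q : (0 < size P)%N -> chain a P b ->
  pwaffine f P Q -> pwaffine g P Q -> forall x, a <= x <= b -> f x = g x.
Proof.
move=> P0 hc hf hg x /andP [ax xb].
have E I J : affine f I J -> affine g I J -> 0 < I.2 ->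
    I.1 <= x <= I.1 + I.2 -> f x = g x.
  move=> hF hG I0 /andP [h1 h2].
  have ht : 0 <= (x - I.1) / I.2 <= 1.
    apply/andP; split; first by apply: divr_ge0; lra.
    by rewrite ler_pdivrMr //; lra.
  have -> : x = I.1 + I.2 * ((x - I.1) / I.2) by field; rewrite gt_eqF.
  by rewrite hF // hG.
have [xa|ax'] := leP x a.
  have {ax xa} xa : x = a by apply/eqP; rewrite eq_le ax xa.
  case: P Q P0 hc hf hg => [//|I P] [//|J Q] _ /= [hI I0 _] [hf _] [hg _].
  by apply: (E _ _ hf hg I0); rewrite xa hI lexx lerDl ltW.
move=> {P0 ax}; elim: P a Q hc hf hg ax' => [|I P IH] a [|J Q] //=.
  by move=> ab; lra.
move=> [hI I0 hP] [hf hfP] [hg hgP] ax.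
have [xI|xI] := leP x (a + I.2).
  by apply: (E _ _ hf hg I0); rewrite hI (ltW ax) xI.
exact: IH hP hfP hgP xI.
Qed.

Definition bps (P : seq ival) : seq rat := rcons (map fst P) 1.

(** At the shared breakpoint [a1] the first segment still applies, but both segments give [b1]
    there. The point [(a2, b2)] prevents the shorter list from being a singleton, on which [pl_eval]
    is the identity. *)
Lemma pl_eval_skip a0 b0 a1 b1 a2 b2 r x : a1 < a2 -> a0 < a1 -> a1 <= x ->
  pl_eval [:: (a0, b0), (a1, b1), (a2, b2) & r] x =
  pl_eval [:: (a1, b1), (a2, b2) & r] x.
Proof.
move=> h1 h0 hx; rewrite [LHS]/=.
case: ifP => // /andP [_ hx'].
have -> : x = a1 by apply/eqP; rewrite eq_le hx hx'.
rewrite /= lexx (ltW h1) /= subrr mulr0 addr0 divfK ?subr_eq0 ?gt_eqF //.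
by rewrite addrC subrK.
Qed.

Lemma pwaffine_ext f g P Q a b : chain a P b -> (forall x, a <= x -> f x = g x) ->
  pwaffine f P Q -> pwaffine g P Q.
Proof.
elim: P Q a => [|I P IH] [|J Q] //= a [hI I0 hP] E [h hQ]; split.
  move=> t ht; rewrite -h // E // hI.
  by rewrite lerDl mulr_ge0 // ?(ltW I0) //; case/andP: ht.
apply: (IH _ _ hP _ hQ) => x hx; apply: E; lra.
Qed.

Lemma bps_cons I P : bps (I :: P) = I.1 :: bps P.
Proof. by []. Qed.

Lemma bps_chain a P : chain a P 1 -> exists r, bps P = a :: r.
Proof.
case: P => [|I P] /=; first by move=> ->; exists [::].
by move=> [<- _ _]; exists (bps P).
Qed.

Lemma pwaffine_pl_eval P Q : chain 0 P 1 -> chain 0 Q 1 -> size P = size Q ->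
  pwaffine (pl_eval (zip (bps P) (bps Q))) P Q.
Proof.
suff H a b : chain a P 1 -> chain b Q 1 -> size P = size Q ->
  pwaffine (pl_eval (zip (bps P) (bps Q))) P Q by exact: H.
elim: P Q a b => [|I P IH] [|J Q] // a b.
move=> [hI I0]; rewrite -/chain => hP [hJ J0]; rewrite -/chain => hQ [hs].
have [r Er] := bps_chain hP; have [r' Er'] := bps_chain hQ.
rewrite !bps_cons hI hJ; split.
  move=> t /andP [t0 t1]; rewrite Er Er' /= hI hJ.
  have h0 : 0 <= I.2 * t by rewrite mulr_ge0 // ltW.
  have h1 : I.2 * t <= I.2 by rewrite ler_piMr // ltW.
  rewrite ifT; first by field; rewrite gt_eqF; lra.
  by apply/andP; split; lra.
case: P Q IH hs hP hQ Er Er' => [|I' P] [|J' Q] // IH hs hP hQ Er Er'.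
(* The remaining pieces lie to the right of the first one, where dropping its segment changes
   nothing. *)
apply: (pwaffine_ext hP _ (IH _ _ _ hP hQ hs)) => x hx.
move: hP hQ => [hI' I0']; rewrite -/chain => hP [hJ' J0']; rewrite -/chain => hQ.
have [s Es] := bps_chain hP; have [s' Es'] := bps_chain hQ.
rewrite !bps_cons Es Es' hI' hJ'.
by symmetry; apply: pl_eval_skip; lra.
Qed.

(** * Tree pairs of the generators *)

Definition caret : tree := Node (fun _ => Leaf).
Definition hang (j : nat) (t : tree) : tree :=
  Node (fun i => if i == j then t else Leaf).

Lemma leaves_caret q I : leaves q caret I = children q I.
Proof. by rewrite /= /children /mkseq; elim: (iota 0 q) => //= i s ->. Qed.

Lemma iota_rcons m n : iota m n.+1 = rcons (iota m n) (m + n)%N.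
Proof. by rewrite -addn1 iotaD cats1. Qed.

Lemma iota_cut j q : (j < q)%N ->
  iota 0 q = iota 0 j ++ j :: iota j.+1 (q - j.+1).
Proof.
move=> h; have {1}-> : q = (j + (q - j.+1).+1)%N by lia.
by rewrite iotaD.
Qed.

Lemma leaves_hang q j t I : (j < q)%N ->
  leaves q (hang j t) I = map (child q I) (iota 0 j) ++
    leaves q t (child q I j) ++ map (child q I) (iota j.+1 (q - j.+1)).
Proof.
move=> jq /=; rewrite /mkseq (iota_cut jq) map_cat flatten_cat /= eqxx.
have H s : j \notin s -> flatten [seq leaves q (if i == j then t else Leaf)
    (child q I i) | i <- s] = map (child q I) s.
  elim: s => //= i s IH; rewrite inE negb_or eq_sym => /andP [/negbTE -> /IH ->].
  by [].
by rewrite !H // mem_iota; lia.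
Qed.

Lemma nleaves_hang q j t : (j < q)%N ->
  nleaves q (hang j t) = (q.-1 + nleaves q t)%N.
Proof.
move=> jq; rewrite -(size_leaves q _ unit_ival) leaves_hang //.
rewrite !size_cat !size_map !size_iota size_leaves; lia.
Qed.

Lemma nleaves_caret q : nleaves q caret = q.
Proof. by rewrite -(size_leaves q _ unit_ival) leaves_caret size_mkseq. Qed.

Definition rescale (K I : ival) : ival := (K.1 + K.2 * I.1, K.2 * I.2).

Lemma leaves_rescale q t K I :
  leaves q t (rescale K I) = map (rescale K) (leaves q t I).
Proof.
elim: t I => [//|c IH] I /=.
rewrite map_flatten /mkseq -map_comp; congr flatten; apply: eq_map => i /=.
by rewrite -IH; congr leaves; rewrite /child /rescale /=; congr pair; ring.
Qed.

Lemma rng_bps q j : (j < q)%N -> rng q j = bps (leaves q (hang j caret) unit_ival).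
Proof.
move=> jq; have q0 : q%:R != 0 :> rat by rewrite pnatr_eq0; lia.
rewrite leaves_hang // leaves_caret /bps /rng !map_cat /children /mkseq -!map_comp.
have E1 s : [seq (fst \o child q unit_ival) i | i <- s] = map (qfrac q) s.
  by apply: eq_map => i; rewrite /= add0r mul1r.
set h := fun t => qfrac q j + qfrac (q * q) t.
have E2 s : [seq (fst \o child q (child q unit_ival j)) i | i <- s] = map h s.
  apply: eq_map => i; rewrite /= add0r !mul1r /h /qfrac natrM; congr (_ + _).
  by field.
have Eh0 : qfrac q j = h 0%N by rewrite /h /qfrac mul0r addr0.
have Ehq : h q = qfrac q j.+1.
  by rewrite /h /qfrac natrM -natr1; field.
have El : 1 = qfrac q (j.+1 + (q - j.+1)).
  by rewrite /qfrac subnKC // divff.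
(* In [rng] the fine block runs over t = 1..q, whereas the left endpoints run over t = 0..q-1; the
   points j/q and (j+1)/q change blocks. *)
rewrite !E1 E2 {1}El iota_rcons map_rcons cat_rcons Eh0 !rcons_cat; congr (_ ++ _).
rewrite -map_rcons -iota_rcons -cat_cons -[h 0%N :: _]/(map h (iota 0 q.+1)).
by rewrite iota_rcons map_rcons cat_rcons Ehq.
Qed.

Lemma dom0_rng q : (0 < q)%N -> dom0 q = rng q q.-1.
Proof. by move=> q0; rewrite /dom0 /rng subn1 prednK // subnn cats0. Qed.

Lemma shiftq_bps q t : (0 < q)%N ->
  [seq qfrac q i | i <- iota 0 q.-1] ++ shiftq q (bps (leaves q t unit_ival)) =
  bps (leaves q (hang q.-1 t) unit_ival).
Proof.
move=> q0; have q0' : q%:R != 0 :> rat by rewrite pnatr_eq0; lia.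
rewrite leaves_hang ?prednK // subnn /= cats0 /bps map_cat rcons_cat /shiftq.
rewrite map_rcons -!map_comp; congr (_ ++ rcons _ _).
- by apply: eq_map => i; rewrite /= add0r mul1r.
- have -> : child q unit_ival q.-1 = rescale (child q unit_ival q.-1) unit_ival.
    by rewrite /rescale /child /= mulr0 addr0 mulr1.
  rewrite leaves_rescale -map_comp; apply: eq_map => I /=.
  by rewrite subn1 /qfrac; ring.
- by rewrite subn1 /qfrac -mulrDl natr1 prednK // divff.
Qed.

(** The domain tree is always a right spine, of three carets for x_{q-1} and of two otherwise. *)
Definition gen_dom (q j : nat) : tree :=
  if j == q.-1 then hang q.-1 (hang q.-1 caret) else hang q.-1 caret.
Definition gen_rng (q j : nat) : tree :=
  if j == q.-1 then hang q.-1 (hang 0 caret) else hang j caret.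

Lemma gen_pts_bps q j : (j < q)%N ->
  gen_pts q j = (bps (leaves q (gen_dom q j) unit_ival),
                 bps (leaves q (gen_rng q j) unit_ival)).
Proof.
move=> jq; have q0 : (0 < q)%N by lia.
rewrite /gen_pts /gen_dom /gen_rng; case: eqP => h.
  by rewrite dom0_rng // !rng_bps ?prednK // !shiftq_bps.
by rewrite dom0_rng // !rng_bps ?prednK.
Qed.

Lemma nleaves_gen_dom q j : (j < q)%N -> (nleaves q (gen_dom q j) <= 3 * q)%N.
Proof.
move=> jq; rewrite /gen_dom; case: ifP => _;
  rewrite !nleaves_hang ?nleaves_caret; lia.
Qed.

Lemma nleaves_gen_rng q j : (j < q)%N ->
  nleaves q (gen_rng q j) = nleaves q (gen_dom q j).
Proof.
by move=> jq; rewrite /gen_dom /gen_rng; case: ifP => _;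
  rewrite !nleaves_hang ?nleaves_caret; lia.
Qed.

Lemma pwaffine_gen q j : (j < q)%N ->
  pwaffine (gen q j) (leaves q (gen_dom q j) unit_ival)
                     (leaves q (gen_rng q j) unit_ival) /\
  pwaffine (gen_inv q j) (leaves q (gen_rng q j) unit_ival)
                         (leaves q (gen_dom q j) unit_ival).
Proof.
move=> jq; have q0 : (0 < q)%N by lia.
have C t : chain 0 (leaves q t unit_ival) 1.
  by apply: (chain_treepart q0); exists t.
rewrite /gen /gen_inv gen_pts_bps //.
by split; apply: pwaffine_pl_eval; rewrite ?size_leaves ?nleaves_gen_rng.
Qed.

Definition valid (q : nat) (w : seq (nat * bool)) := all (fun l => (l.1 < q)%N) w.

Lemma evalw_cat q v w x : evalw q (v ++ w) x = evalw q v (evalw q w x).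
Proof. by elim: v => //= l v ->. Qed.

(** * Tree pair of a word *)

Lemma pwaffine_id P : pwaffine id P P.
Proof. by elim: P => //= I P IH; split. Qed.

(** The range tree of [w] and the domain tree of the next letter are joined; the expansion is pulled
    back to [P] and pushed forward to the range of the letter. By [join], each letter adds at most
    3q leaves. *)
Lemma word_treepart q w : (0 < q)%N -> valid q w -> exists P Q,
  [/\ treepart q P, treepart q Q, pwaffine (evalw q w) P Q &
      (size P <= 3 * q * size w + 1)%N].
Proof.
move=> q0; elim: w => [|[j b] w IH] /=.
  exists [:: unit_ival], [:: unit_ival]; split; [by exists Leaf | by exists Leaf | | by rewrite muln0].
  exact: pwaffine_id.
move=> /andP [jq /IH [P [_ [hP [t <-] hPQ hs]]]].
have [u [v [huv hu hv]]] : exists u v,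
  [/\ pwaffine (letter q (j, b)) (leaves q u unit_ival) (leaves q v unit_ival),
      (nleaves q u <= 3 * q)%N & nleaves q v = nleaves q u].
  have [h1 h2] := pwaffine_gen jq; have h3 := nleaves_gen_dom jq.
  have h4 := nleaves_gen_rng jq.
  case: b; [exists (gen_rng q j), (gen_dom q j) | exists (gen_dom q j), (gen_rng q j)];
    by split=> //; rewrite ?h4.
have [L [M [hL hM E hLM]]] := join t u q0.
have hPt := pwaffine_size hPQ; rewrite size_leaves in hPt.
exists (refine q L P), (refine q M (leaves q v unit_ival)); split.
- by apply: treepart_refine; rewrite ?hL.
- by apply: treepart_refine; [exists v | rewrite size_leaves hv].
- apply: (@pwaffine_comp _ _ _ (refine q L (leaves q t unit_ival))).
    by apply: pwaffine_refine; rewrite ?hL.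
  by rewrite E; apply: pwaffine_refine; rewrite ?size_leaves ?hM.
- by rewrite size_refine ?hL //; lia.
Qed.

(** * Word length is linear in the number of leaves *)

Definition spine (q a : nat) (I : ival) : seq ival :=
  leaves q (iter a (hang q.-1) Leaf) I.

Lemma spineS q a I : (0 < q)%N -> spine q a.+1 I =
  map (child q I) (iota 0 q.-1) ++ spine q a (child q I q.-1).
Proof.
move=> q0; rewrite /spine iterS leaves_hang ?prednK // subnn.
by rewrite /= cats0.
Qed.

Lemma size_spine q a I : (0 < q)%N -> size (spine q a I) = (a * q.-1).+1.
Proof.
move=> q0; elim: a I => [|a IH] I //.
by rewrite spineS // size_cat size_map size_iota IH mulSn addnS.
Qed.

Definition cut (q j : nat) (P : seq ival) : seq ival :=
  take j P ++ children q (nth unit_ival P j) ++ drop j.+1 P.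

Lemma cut_cat q j A I B : size A = j ->
  cut q j (A ++ I :: B) = A ++ children q I ++ B.
Proof.
move=> <-; rewrite /cut take_size_cat // nth_cat ltnn subnn /= -cat_rcons.
by rewrite drop_size_cat // size_rcons.
Qed.

Lemma children_rcons q I : (0 < q)%N ->
  children q I = rcons (map (child q I) (iota 0 q.-1)) (child q I q.-1).
Proof.
by move=> q0; rewrite /children /mkseq -{2}(prednK q0) iota_rcons map_rcons.
Qed.

(** With the same spine hung at both last leaves, the domain tree of x_j becomes a longer spine, and
    the range tree a spine one caret shorter whose leaf [j] is subdivided. Three carets are the
    least that accommodate x_{q-1}; for the other generators the hung spine has one caret more. *)
Lemma gen_spine q j a : (1 < q)%N -> (j < q)%N -> exists X Y I J b,
  [/\ leaves q (gen_dom q j) unit_ival = rcons X I,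
      leaves q (gen_rng q j) unit_ival = rcons Y J,
      spine q a.+3 unit_ival = X ++ spine q b I &
      cut q j (spine q a.+2 unit_ival) = Y ++ spine q b J].
Proof.
move=> q1 jq; have q0 : (0 < q)%N by lia.
have r0 : (0 < q.-1)%N by lia.
have rq : (q.-1 < q)%N by lia.
set r := q.-1 in r0 rq *; set C := child q unit_ival r.
have Er : (q - r.+1)%N = 0%N by rewrite /r; lia.
set p1 := fun I => map (child q I) (iota 0 r).
rewrite /gen_dom /gen_rng -/r; case: eqP => [->|/eqP jr].
  exists (p1 unit_ival ++ p1 C ++ p1 (child q C r)),
    (p1 unit_ival ++ children q (child q C 0) ++ map (child q C) (iota 1 r.-1)),
    (child q (child q C r) r), (child q C r), a; split.
  - rewrite !leaves_hang // leaves_caret Er /= !cats0 children_rcons //.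
    by rewrite !rcons_cat.
  - rewrite !leaves_hang // leaves_caret Er /= !cats0 !rcons_cat.
    have -> : (q - 1)%N = r.-1.+1 by rewrite /r; lia.
    by rewrite iota_rcons map_rcons add1n prednK.
  - by rewrite !spineS // -!catA.
  - rewrite !spineS // -/r -/C -/(p1 unit_ival) (iota_cut r0) map_cat /= subn1.
    by rewrite cut_cat ?size_map ?size_iota // -!catA.
have {}jr : (j < r)%N by move: jq jr; rewrite /r; lia.
exists (p1 unit_ival ++ p1 C), (map (child q unit_ival) (iota 0 j) ++
  children q (child q unit_ival j) ++
  map (child q unit_ival) (iota j.+1 (r - j.+1))), (child q C r), C, a.+1; split.
- rewrite !leaves_hang // leaves_caret Er /= !cats0 children_rcons //.
  by rewrite !rcons_cat.
- rewrite !leaves_hang // leaves_caret !rcons_cat.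
  have -> : (q - j.+1)%N = (r - j.+1).+1 by rewrite /r; lia.
  by rewrite iota_rcons map_rcons subnKC.
- by rewrite !spineS // -!catA.
- rewrite spineS // -/r -/C (iota_cut jr) map_cat /= -catA /=.
  by rewrite cut_cat ?size_map ?size_iota // -!catA.
Qed.

(** * Subdivisions related by short words *)

Lemma pwaffine_last q f t X Y I J : pwaffine f (rcons X I) (rcons Y J) ->
  pwaffine f (X ++ leaves q t I) (Y ++ leaves q t J).
Proof.
move=> h; have hs := pwaffine_size h; rewrite !size_rcons in hs.
case: hs => hs; rewrite -!cats1 in h.
have [h1 [h2 _]] := pwaffine_catE hs h.
by apply: pwaffine_cat => //; exact: pwaffine_leaves.
Qed.

(** Recording a word for each direction makes symmetry immediate, without formal inverses of
    words. *)
Definition reach (q n : nat) (P Q : seq ival) : Prop := exists v w,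
  [/\ valid q v /\ (size v <= n)%N, valid q w /\ (size w <= n)%N,
      pwaffine (evalw q v) P Q & pwaffine (evalw q w) Q P].

Lemma reach_refl q P : reach q 0 P P.
Proof. by exists [::], [::]; split=> //; exact: pwaffine_id. Qed.

Lemma reach_sym q n P Q : reach q n P Q -> reach q n Q P.
Proof. by case=> v [w [h1 h2 h3 h4]]; exists w, v. Qed.

Lemma pwaffine_evalw_cat q v w P Q R : pwaffine (evalw q w) P Q ->
  pwaffine (evalw q v) Q R -> pwaffine (evalw q (v ++ w)) P R.
Proof.
elim: P Q R => [|I P IH] [|J Q] [|K R] //= [h hP] [h' hQ]; split.
  by move=> t ht; rewrite evalw_cat h // h'.
exact: IH hP hQ.
Qed.

Lemma reach_trans q m n P Q R : reach q m P Q -> reach q n Q R ->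
  reach q (m + n) P R.
Proof.
move=> [v [w [[v1 v2] [w1 w2] h h']]] [v' [w' [[v1' v2'] [w1' w2'] g g']]].
exists (v' ++ v), (w ++ w'); split.
- by rewrite /valid all_cat size_cat; split; [exact/andP | lia].
- by rewrite /valid all_cat size_cat; split; [exact/andP | lia].
- exact: pwaffine_evalw_cat h g.
- exact: pwaffine_evalw_cat g' h'.
Qed.

Lemma reach_leq q m n P Q : (m <= n)%N -> reach q m P Q -> reach q n P Q.
Proof.
move=> mn [v [w [[v1 v2] [w1 w2] h h']]].
by exists v, w; split=> //; split=> //; exact: leq_trans mn.
Qed.

(* The whole tree whose right spine carries the trees of L; the last tree of L
   sits at the end of the spine, so size L - 1 is a multiple of q - 1. *)
Definition forest (q : nat) (L : seq tree) : seq ival :=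
  refine q L (spine q ((size L).-1 %/ q.-1) unit_ival).

(** The generator with index [size A] acts at that position, so the index must be below q. The
    conditions on [size A + size B] say that the unsplit list hangs on a spine of at least two
    carets, as [gen_spine] requires. *)
Lemma reach_split q A B c : (1 < q)%N -> (size A < q)%N ->
  (2 * q.-1 <= size A + size B)%N -> (q.-1 %| size A + size B)%N ->
  reach q 1 (forest q (A ++ Node c :: B)) (forest q (A ++ mkseq c q ++ B)).
Proof.
move=> q1 Aq hAB /dvdnP [a ha].
have r0 : (0 < q.-1)%N by lia.
have q0 : (0 < q)%N by lia.
have [b Eb] : exists b, a = b.+2.
  exists a.-2; move: hAB; rewrite ha leq_pmul2r //; lia.
rewrite /forest !size_cat size_mkseq /= addnS /= ha mulnK // Eb.
have -> : (size A + (q + size B)).-1 = (b.+3 * q.-1)%N.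
  by rewrite mulSn -Eb -ha; lia.
rewrite mulnK //.
have hs : (size A < size (spine q b.+2 unit_ival))%N.
  by rewrite size_spine // -Eb -ha; lia.
rewrite (leaves_split _ unit_ival _ hs) -/(cut q (size A) _).
have [h1 h2] := pwaffine_gen Aq.
have [X [Y [I [J [d [EX EY E1 E2]]]]]] := gen_spine b q1 Aq.
rewrite EX EY in h1 h2.
have {}h1 := pwaffine_last q (iter d (hang q.-1) Leaf) h1.
have {}h2 := pwaffine_last q (iter d (hang q.-1) Leaf) h2.
rewrite -!/(spine q d _) -E1 -E2 in h1 h2.
have hz : size (A ++ mkseq c q ++ B) = size (spine q b.+3 unit_ival).
  by rewrite size_spine // !size_cat size_mkseq mulSn -Eb -ha; lia.
(* The generator itself merges, carrying the longer spine to the cut one; splitting is done by its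
   inverse. *)
exists [:: (size A, true)], [:: (size A, false)].
split; rewrite /valid /= ?Aq //.
  by apply: pwaffine_refine h2; rewrite hz -(pwaffine_size h1).
exact: pwaffine_refine hz h1.
Qed.

(** * Reduction of forests to a normal form *)

Fixpoint nodes (q : nat) (t : tree) : nat :=
  if t is Node c then (sumn (mkseq (fun i => nodes q (c i)) q)).+1 else 1%N.

Definition nodess (q : nat) (L : seq tree) : nat := sumn (map (nodes q) L).

(** Leaves count as nodes, since absorbing a leaf into the comb may cost a generator just as opening
    an inner node does. Strictness at each of the q >= 2 children pays for the root. *)
Lemma nodes_lt q t : (1 < q)%N -> (nodes q t < 2 * nleaves q t)%N.
Proof.
move=> q1; elim: t => [//|c IH] /=.
have H s : (sumn [seq nodes q (c i) | i <- s] + size s <=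
            2 * sumn [seq nleaves q (c i) | i <- s])%N.
  by elim: s => //= i s IHs; move: (IH i); lia.
by move: (H (iota 0 q)); rewrite size_iota /mkseq; lia.
Qed.

Lemma nodess_le q L : (1 < q)%N -> (nodess q L <= 2 * nleavess q L)%N.
Proof.
move=> q1; rewrite /nodess /nleavess; elim: L => //= t L.
by move: (nodes_lt t q1); lia.
Qed.

Lemma nodess_cat q L M : nodess q (L ++ M) = (nodess q L + nodess q M)%N.
Proof. by rewrite /nodess map_cat sumn_cat. Qed.

Lemma nleavess_cat q L M : nleavess q (L ++ M) = (nleavess q L + nleavess q M)%N.
Proof. by rewrite /nleavess map_cat sumn_cat. Qed.

(** Each caret adds q - 1 leaves. This preserves the divisibility conditions when a tree is
    absorbed. *)
Lemma nleaves_mod q t : (0 < q)%N -> exists k, nleaves q t = (k * q.-1).+1.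
Proof.
move=> q0; elim: t => [|c IH] /=; first by exists 0%N.
have H s : exists k, sumn [seq nleaves q (c i) | i <- s] = (k * q.-1 + size s)%N.
  elim: s => [|i s [k Hk]] /=; first by exists 0%N.
  by have [k' ->] := IH i; exists (k' + k)%N; rewrite Hk mulnDl; lia.
have [k ->] := H (iota 0 q); exists k.+1.
by rewrite size_iota mulSn; lia.
Qed.

Lemma nleaves_Node q c : nleaves q (Node c) = nleavess q (mkseq c q).
Proof. by rewrite /nleavess /mkseq -map_comp. Qed.

Lemma nodes_Node q c : nodes q (Node c) = (nodess q (mkseq c q)).+1.
Proof. by rewrite /nodess /mkseq -map_comp. Qed.

(* The normal form of a forest with n leaves before its untouched tail: a
   left comb at position 0, followed by fewer than q - 1 single leaves. The
   comb is the counter that lets generators acting only on the positions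
   0, ..., q - 1 reach every tree of the list. *)
Definition comb (q n : nat) : seq tree :=
  iter (n %/ q.-1) (hang 0) Leaf :: nseq (n %% q.-1) Leaf.

Lemma nseq_rcons (T : Type) n (x : T) s : nseq n x ++ x :: s = nseq n.+1 x ++ s.
Proof. by elim: n => //= n ->. Qed.

Lemma mkseq_hang0 q t : (0 < q)%N ->
  mkseq (fun i => if i == 0%N then t else Leaf) q = t :: nseq q.-1 Leaf.
Proof.
case: q => // q _; rewrite /mkseq /=; congr cons.
have H m : (0 < m)%N -> [seq (if i == 0%N then t else Leaf) | i <- iota m q] =
  nseq q Leaf.
  by elim: q m => //= q IH m m0; rewrite IH // gtn_eqF.
exact: H.
Qed.

(** One step of the counter. The leaf usually just joins the single leaves, at no cost; once q - 1
    of them are present, x_0 merges them with the comb, which grows by one caret. *)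
Lemma reach_comb_Leaf q n X : (1 < q)%N -> (2 * q.-1 <= size X)%N ->
  (q.-1 %| n + 1 + size X)%N ->
  reach q 1 (forest q (comb q n ++ Leaf :: X)) (forest q (comb q n.+1 ++ X)).
Proof.
move=> q1 hX hd; have r0 : (0 < q.-1)%N by lia.
rewrite /comb /= nseq_rcons.
have hn := divn_eq n q.-1; have hm := ltn_pmod n r0.
set k := (n %/ q.-1)%N in hn *; set m := (n %% q.-1)%N in hn hm *.
have [E|E] := eqVneq m.+1 q.-1; last first.
  have hm' : (m.+1 < q.-1)%N by lia.
  have -> : (n.+1 %/ q.-1)%N = k by rewrite hn -addnS divnMDl // divn_small // addn0.
  have -> : (n.+1 %% q.-1)%N = m.+1 by rewrite hn -addnS modnMDl modn_small.
  exact: reach_leq (reach_refl _ _).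
have En : n.+1 = (k.+1 * q.-1)%N by rewrite hn -addnS E mulSn addnC.
rewrite E En mulnK // modnMl iterS; apply: reach_sym.
rewrite -[_ :: nseq q.-1 Leaf ++ X]cat_cons -mkseq_hang0; last by lia.
apply: (@reach_split q [::]) => //=; rewrite ?add0n //; first by lia.
by move: hd; rewrite addn1 En dvdn_addr // dvdn_mull.
Qed.

(** Counter and tail are quantified because the children of a node meet different ones. The
    divisibility says that the whole list has length 1 modulo q - 1. *)
Definition combs (q : nat) (t : tree) : Prop :=
  forall n X, (2 * q.-1 <= size X)%N -> (q.-1 %| n + 1 + size X)%N ->
  reach q (nodes q t) (forest q (comb q n ++ t :: X))
                      (forest q (comb q (n + nleaves q t) ++ X)).

Lemma reach_comb_map q (c : nat -> tree) s n X : (1 < q)%N ->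
  (forall i, combs q (c i)) ->
  (2 * q.-1 <= size X)%N -> (q.-1 %| n + size s + size X)%N ->
  reach q (nodess q (map c s)) (forest q (comb q n ++ map c s ++ X))
          (forest q (comb q (n + nleavess q (map c s)) ++ X)).
Proof.
move=> q1 H; elim: s n => [|i s IH] n hX hd /=.
  by rewrite /nleavess /= addn0; exact: reach_refl.
rewrite /nodess /nleavess /=; apply: reach_trans.
  apply: H; rewrite size_cat size_map; first by lia.
  by have -> : (n + 1 + (size s + size X) = n + (size s).+1 + size X)%N by lia.
rewrite addnA; apply: IH => //.
have [k ->] := nleaves_mod (c i) (ltnW q1).
have -> : (n + (k * q.-1).+1 + size s + size X =
           k * q.-1 + (n + size (i :: s) + size X))%N by move=> /=; lia.
by rewrite dvdn_addr // dvdn_mull.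
Qed.

Lemma reach_comb_tree q t : (1 < q)%N -> combs q t.
Proof.
move=> q1; elim: t => [|c IH] n X hX hd.
  by rewrite addn1; exact: reach_comb_Leaf.
have r0 : (0 < q.-1)%N by lia.
have hm := ltn_pmod n r0; have hn := divn_eq n q.-1.
have hs : (size (comb q n) = (n %% q.-1).+1)%N by rewrite /= size_nseq.
(* The comb list has at most q - 1 entries, so the node sits at a position below q and one generator
   opens it; its children are then absorbed in turn. *)
rewrite [nodes q _]/= -add1n; apply: reach_trans.
  apply: reach_split => //; rewrite hs; [by lia | by lia |].
    have E : (n + 1 + size X = n %/ q.-1 * q.-1 + ((n %% q.-1).+1 + size X))%N.
      by rewrite {1}hn; lia.
    by move: hd; rewrite E dvdn_addr // dvdn_mull.
have := @reach_comb_map q c (iota 0 q) n X q1 IH hX.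
rewrite /nodess /nleavess /mkseq -!map_comp size_iota; apply.
have -> : (n + q + size X = q.-1 + (n + 1 + size X))%N by lia.
by rewrite dvdn_addr.
Qed.

Lemma reach_comb q L n X : (1 < q)%N ->
  (2 * q.-1 <= size X)%N -> (q.-1 %| n + size L + size X)%N ->
  reach q (nodess q L) (forest q (comb q n ++ L ++ X))
          (forest q (comb q (n + nleavess q L) ++ X)).
Proof.
move=> q1; rewrite -(mkseq_nth Leaf L) /mkseq size_map size_iota.
rewrite -{1}[size L](size_iota 0).
by apply: reach_comb_map => // i; exact: reach_comb_tree.
Qed.

(** Opens the left spine of the tree at position 0, with [L] collecting the subtrees hanging off it.
    The remaining leaf is the empty comb from which counting starts. *)
Lemma reach_head q t X : (1 < q)%N -> (2 * q.-1 <= size X)%N ->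
  (q.-1 %| size X)%N -> exists L,
  [/\ reach q (nodes q t) (forest q (t :: X)) (forest q (Leaf :: L ++ X)),
      (nleavess q L).+1 = nleaves q t, (nodess q L <= nodes q t)%N &
      (q.-1 %| size L)%N].
Proof.
move=> q1; elim: t X => [|c IH] X hX hd.
  by exists [::]; split=> //; exact: reach_leq (reach_refl _ _).
have E : mkseq c q = c 0%N :: map c (iota 1 q.-1) by case: q q1 {IH hX hd}.
have [||L [h1 h2 h3 h4]] := IH 0%N (map c (iota 1 q.-1) ++ X).
- by rewrite size_cat; lia.
- by rewrite size_cat size_map size_iota dvdn_addr.
exists (L ++ map c (iota 1 q.-1)); split.
- rewrite -catA nodes_Node -add1n.
  apply: reach_trans (@reach_split q [::] X c q1 _ _ _) _; rewrite ?add0n //=.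
    by lia.
  by rewrite E; apply: reach_leq h1; rewrite /nodess /= leq_addr.
- by rewrite nleaves_Node E nleavess_cat -addSn h2.
- rewrite nodes_Node E nodess_cat /nodess /= -/(nodess q L) -/(nodess q (map c _)).
  by lia.
- by rewrite size_cat size_map size_iota dvdn_addl.
Qed.

(** [L] lists the subtrees hanging off the right spine of [t], [a] counts its carets, and [J] is the
    last leaf. The final clause allows the spine to be prolonged below [J]. *)
Lemma spine_decomposition q t I : (0 < q)%N -> exists L a P J,
  [/\ size L = (a * q.-1)%N, (nleavess q L).+1 = nleaves q t,
      leaves q t I = rcons P J &
      forall M b, refine q (L ++ M) (spine q (a + b) I) =
                  P ++ refine q M (spine q b J)].
Proof.
move=> q0; elim: t I => [|c IH] I.
  by exists [::], 0%N, [::], I; split.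
have [L [a [P [J [h1 h2 h3 h4]]]]] := IH q.-1 (child q I q.-1).
have E : mkseq c q = rcons (map c (iota 0 q.-1)) (c q.-1).
  by rewrite /mkseq -{1}(prednK q0) iota_rcons map_rcons.
exists (map c (iota 0 q.-1) ++ L), a.+1,
  (refine q (map c (iota 0 q.-1)) (map (child q I) (iota 0 q.-1)) ++ P), J; split.
- by rewrite size_cat size_map size_iota h1 mulSn.
- by rewrite nleavess_cat -addnS h2 nleaves_Node E -cats1 nleavess_cat /nleavess /= addn0.
- rewrite leaves_Node E children_rcons // -!cats1 refine_cat ?size_map //.
  by rewrite refine1 h3 -cats1 catA.
- move=> M b; rewrite addSn spineS // -!catA refine_cat ?size_map //.
  by rewrite h4.
Qed.

(** The two carets added at the last leaf supply the 2(q - 1) tail leaves needed by the splits.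
    Opening the first tree and then absorbing everything each cost at most twice the number of
    leaves, hence the factor 4. *)
Lemma reach_normal_form q t : (1 < q)%N -> exists P J,
  leaves q t unit_ival = rcons P J /\
  reach q (4 * nleaves q t) (P ++ spine q 2 J)
    (forest q (comb q (nleaves q t).-1 ++ nseq (2 * q.-1) Leaf)).
Proof.
move=> q1; have q0 : (0 < q)%N by lia.
have r0 : (0 < q.-1)%N by lia.
have [L [a [P [J [h1 h2 h3 h4]]]]] := spine_decomposition t unit_ival q0.
exists P, J; split=> //.
have -> : P ++ spine q 2 J = forest q (L ++ Leaf :: nseq (2 * q.-1) Leaf).
  rewrite /forest size_cat /= size_nseq addnS h1 -mulnDl mulnK // h4.
  by rewrite -[Leaf :: _]/(nseq _.+1 Leaf) refine_nseq // size_spine.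
have [u [M EM]] : exists u M, L ++ [:: Leaf] = u :: M.
  by case: (L) => [|u M]; [exists Leaf, [::] | exists u, (M ++ [:: Leaf])].
have hM : (size M = a * q.-1)%N.
  by have := congr1 size EM; rewrite size_cat /= addn1 h1 => -[].
have hn : (nleaves q t = nleaves q u + nleavess q M)%N.
  have := congr1 (nleavess q) EM; rewrite nleavess_cat [nleavess q (_ :: M)]/=.
  by rewrite {2}/nleavess /= addn0 addn1 h2.
have hdiv m : (q.-1 %| size (nseq (m * q.-1) Leaf))%N by rewrite size_nseq dvdn_mull.
rewrite -cat1s catA EM cat_cons.
have [||N [g1 g2 g3 g4]] := @reach_head q u (M ++ nseq (2 * q.-1) Leaf) q1.
- by rewrite size_cat size_nseq leq_addl.
- by rewrite size_cat hM dvdn_addr ?hdiv // dvdn_mull.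
have E0 : [:: Leaf] = comb q 0 by rewrite /comb div0n mod0n.
have g5 := @reach_comb q (N ++ M) 0 (nseq (2 * q.-1) Leaf) q1.
rewrite -E0 -catA cat1s in g5.
apply: reach_leq (reach_trans g1 _); last first.
  have -> : ((nleaves q t).-1 = 0 + nleavess q (N ++ M))%N.
    by rewrite nleavess_cat hn -g2; lia.
  apply: g5; first by rewrite size_nseq.
  by rewrite add0n size_cat hM !dvdn_addr ?hdiv ?dvdn_add // dvdn_mull.
rewrite nodess_cat; have := nodes_lt u q1; have := nodess_le M q1.
by rewrite hn; lia.
Qed.

(** Both trees have equally many leaves, hence the same normal form; going there from one and back
    to the other costs 4 + 4 generators per leaf. *)
Lemma word_length_treepart q f P Q : (1 < q)%N -> treepart q P ->
  treepart q Q -> pwaffine f P Q -> exists w,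
  [/\ valid q w, (size w <= 8 * size P)%N &
      forall x, 0 <= x <= 1 -> f x = evalw q w x].
Proof.
move=> q1 [t <-] [u <-] h; have q0 : (0 < q)%N by lia.
have hs := pwaffine_size h; rewrite !size_leaves in hs.
have [X [I [EX hX]]] := reach_normal_form t q1.
have [Y [J [EY hY]]] := reach_normal_form u q1.
rewrite -hs in hY.
have [w [_ [[w1 w2] _ hw _]]] := reach_trans hX (reach_sym hY).
exists w; split=> //; first by rewrite size_leaves; apply: leq_trans w2 _; lia.
rewrite EX EY in h.
apply: (pwaffine_unique _ _ (pwaffine_last q (iter 2 (hang q.-1) Leaf) h) hw).
  by rewrite size_cat -/(spine q 2 I) size_spine // addnS.
(* Expanding only the last leaf gives a tree partition again, so its pieces cover [0, 1]. *)
have -> : X ++ leaves q (iter 2 (hang q.-1) Leaf) I =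
  refine q (nseq (size X) Leaf ++ [:: iter 2 (hang q.-1) Leaf]) (rcons X I).
  rewrite -cats1 refine_cat ?size_nseq // refine1 refine_nseq //.
apply: (chain_treepart q0); apply: treepart_refine; first by exists t.
by rewrite size_cat size_nseq addn1 size_rcons.
Qed.

(** * From p-ary to p^k-ary trees *)

Lemma natr_neq0 n : (0 < n)%N -> n%:R != 0 :> rat.
Proof. by move=> n0; rewrite pnatr_eq0 -lt0n. Qed.

Lemma children_mul p m I : (0 < p)%N -> (0 < m)%N ->
  children (p * m) I = flatten [seq children m (child p I i) | i <- iota 0 p].
Proof.
move=> p0 m0; have p0' := natr_neq0 p0; have m0' := natr_neq0 m0.
rewrite {1}/children /mkseq.
have H n : map (child (p * m) I) (iota 0 (n * m)) =
  flatten [seq children m (child p I i) | i <- iota 0 n].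
  elim: n => [//|n IH].
  rewrite iota_rcons map_rcons flatten_rcons -IH mulSn addnC iotaD map_cat.
  congr (_ ++ _); rewrite /children /mkseq !add0n -[(n * m)%N]addn0 iotaDl.
  rewrite -map_comp; apply: eq_map => i; rewrite /child /= !natrD !natrM.
  by congr pair; field; rewrite p0' m0'.
exact: H.
Qed.

Lemma children1 I : children 1 I = [:: I].
Proof. by case: I => a l; rewrite /children /child /mkseq /= mul0r mulr0 addr0 divr1. Qed.

Definition full (n : nat) : tree := iter n (fun t => Node (fun _ => t)) Leaf.

Lemma leaves_full p n I : (0 < p)%N -> leaves p (full n) I = children (p ^ n) I.
Proof.
move=> p0; elim: n I => [|n IH] I; first by rewrite expn0 children1.
rewrite expnS children_mul ?expn_gt0 ?p0 //= /mkseq; congr flatten.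
by apply: eq_map => i; rewrite IH.
Qed.

Lemma nleaves_full p n : (0 < p)%N -> nleaves p (full n) = (p ^ n)%N.
Proof.
by move=> p0; rewrite -(size_leaves p _ unit_ival) leaves_full // size_mkseq.
Qed.

(** Each p^k-ary caret becomes the full p-ary tree of height k, with the converted children grafted
    onto its leaves. *)
Lemma treepart_of_pow p k P : (0 < p)%N -> treepart (p ^ k) P -> treepart p P.
Proof.
move=> p0; set q := (p ^ k)%N.
have H t : exists t', forall I, leaves p t' I = leaves q t I.
  elim: t => [|c IH]; first by exists Leaf.
  have Hs s : exists cs, size cs = size s /\ forall Is, size Is = size s ->
      refine p cs Is = refine q (map c s) Is.
    elim: s => [|i s [cs [hcs E]]]; first by exists [::]; split=> // -[].
    have [t' ht'] := IH i.
    exists (t' :: cs); split=> [|[//|I Is] [hI]]; first by rewrite /= hcs.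
    by rewrite /= !refine_cons ht' E.
  have [cs [hcs E]] := Hs (iota 0 q); rewrite size_iota in hcs E.
  have [|u hu] := @graft p (full k) cs; first by rewrite nleaves_full.
  exists u => I; rewrite hu leaves_full // E ?size_mkseq //.
  by rewrite -leaves_Node.
by case=> t <-; have [t' ht'] := H t; exists t'.
Qed.

Lemma leaves_depth q t I d X : I.2 = q%:R ^- d -> X \in leaves q t I ->
  exists e, X.2 = q%:R ^- e.
Proof.
elim: t I d => [|c IH] I d hI /=; first by rewrite inE => /eqP ->; exists d.
move=> /flatten_mapP [i _]; apply: (IH _ _ d.+1).
by rewrite /= hI exprS invfM mulrC.
Qed.

Lemma expr_inv_inj (p : nat) : (1 < p)%N -> injective (fun n => (p%:R : rat) ^- n).
Proof.
move=> p1 m n /invr_inj; apply: ieexprIn; first by rewrite ltr0n; lia.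
by rewrite -[1]/(1%:R) eqr_nat; lia.
Qed.

(** Here [s] counts the levels from depth [d] to the nearest multiple of k at or below it in the
    tree. No leaf can occur strictly in between, so the tree contains the full tree of height [s],
    and what hangs below is p^k-ary by induction. *)
Lemma leaves_pow p k t I d s : (1 < p)%N ->
  I.2 = p%:R ^- d ->
  (forall X, X \in leaves p t I -> exists m, X.2 = p%:R ^- (k * m)) ->
  (s < k)%N -> (k %| d + s)%N ->
  exists L, size L = (p ^ s)%N /\
    leaves p t I = refine (p ^ k) L (children (p ^ s) I).
Proof.
move=> p1; have p0 : (0 < p)%N by lia.
elim: t I d s => [|c IH] I d s hI hX sk hd.
  have [|m] := hX I; first by rewrite mem_head.
  rewrite hI => /(expr_inv_inj p1) Ed.
  have {sk hd} -> : s = 0%N.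
    by move: hd; rewrite Ed dvdn_addr ?dvdn_mulr // /dvdn modn_small // => /eqP.
  by exists [:: Leaf]; rewrite children1.
have H r : (r < k)%N -> (k %| d.+1 + r)%N -> exists L, size L = (p ^ r.+1)%N /\
    leaves p (Node c) I = refine (p ^ k) L (children (p ^ r.+1) I).
  move=> rk hr.
  have Hs u : (forall i, i \in u -> (i < p)%N) -> exists L,
      size L = (size u * p ^ r)%N /\
      flatten [seq leaves p (c i) (child p I i) | i <- u] = refine (p ^ k) L
        (flatten [seq children (p ^ r) (child p I i) | i <- u]).
    elim: u => [|i u IHu] hu; first by exists [::].
    have [|L [hL EL]] := IHu; first by move=> j hj; apply: hu; rewrite inE hj orbT.
    have ip : (i < p)%N by apply: hu; rewrite mem_head.
    have [|X hX'|M [hM EM]] := IH i (child p I i) d.+1 r _ _ rk hr.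
    - by rewrite /= hI exprS invfM mulrC.
    - by apply: hX; apply/flatten_mapP; exists i; rewrite ?mem_iota.
    exists (M ++ L); split; first by rewrite size_cat hM hL /= mulSn.
    by rewrite /= EM EL refine_cat // hM size_mkseq.
  have [i|L [hL EL]] := Hs (iota 0 p); first by rewrite mem_iota.
  exists L; rewrite hL size_iota expnS; split=> //.
  by rewrite children_mul ?expn_gt0 ?p0.
case: s sk hd => [|s] sk hd; last by apply: H; [lia | rewrite addSnnS].
(* At a depth divisible by k, the p^k trees found k levels further down become the children of a
   single p^k-ary node. *)
have [||L [hL EL]] := H k.-1; [by lia | |].
  by rewrite addSnnS prednK // dvdn_addr // -[d]addn0.
exists [:: Node (nth Leaf L)]; split=> //.
rewrite expn0 children1 refine1 EL prednK //; rewrite prednK // in hL.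
by rewrite leaves_Node -hL mkseq_nth hL.
Qed.

Lemma treepart_pow p k P : (1 < p)%N -> (0 < k)%N -> treepart p P ->
  (forall X, X \in P -> exists m, X.2 = p%:R ^- (k * m)) ->
  treepart (p ^ k) P.
Proof.
move=> p1 k0 [t <-] h.
have [||L [hL E]] := @leaves_pow p k t unit_ival 0 0 p1 _ h k0.
- by rewrite expr0 invr1.
- by rewrite dvdn0.
case: L hL E => [|u [|]] // _; rewrite expn0 children1 refine1 => E.
by exists u.
Qed.

(** The same full tree, of height k - d mod k, is hung on both matching leaves; since their depths
    are congruent, both reach multiples of k. *)
Lemma align_depths p k P Q : (0 < p)%N -> (0 < k)%N -> size P = size Q ->
  (forall x, x \in zip P Q -> exists d e,
     [/\ x.1.2 = p%:R ^- d, x.2.2 = p%:R ^- e & d = e %[mod k]]) ->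
  exists L, [/\ size L = size P, (nleavess p L <= p ^ k * size P)%N,
    forall X, X \in refine p L P -> exists m, X.2 = p%:R ^- (k * m) &
    forall X, X \in refine p L Q -> exists m, X.2 = p%:R ^- (k * m)].
Proof.
move=> p0 k0; elim: P Q => [|I P IH] [|J Q] // => [_ _|[hs] h].
  by exists [::]; split.
have [x hx|L [h1 h2 h3 h4]] := IH Q hs; first by apply: h; rewrite inE hx orbT.
have [|d [e [hI hJ E]]] := h (I, J); first by rewrite mem_head.
have H (K : ival) b X : K.2 = p%:R ^- b -> b = d %[mod k] ->
    X \in leaves p (full (k - d %% k)) K -> exists m, X.2 = p%:R ^- (k * m).
  move=> hK hb; rewrite leaves_full // => /mapP [i _ ->].
  have /dvdnP [m hm] : (k %| b + (k - d %% k))%N.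
    rewrite /dvdn -modnDml hb modnDml -modnDml subnKC ?modnn //.
    by rewrite ltnW // ltn_pmod.
  exists m; rewrite /= hK natrX -invfM -exprD addnC.
  by congr (_ ^- _); rewrite mulnC -hm addnC.
exists (full (k - d %% k) :: L); split.
- by rewrite /= h1.
- rewrite /nleavess /= nleaves_full // mulnS leq_add // leq_pexp2l //.
  by rewrite leq_subr.
- move=> X; rewrite refine_cons mem_cat => /orP [|]; last exact: h3.
  exact: H hI _.
- move=> X; rewrite refine_cons mem_cat => /orP [|]; last exact: h4.
  exact: H hJ (esym E).
Qed.

(** * Slopes *)

Lemma find_piece (A : seq rat) a : head 0 A <= a -> a < last 0 A ->
  exists i, [/\ (i.+1 < size A)%N, nth 0 A i <= a & a < nth 0 A i.+1].
Proof.
move=> hA lA; pose j := find (fun y => a < y) A.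
have hj : has (fun y => a < y) A.
  apply/hasP; exists (last 0 A) => //; case: A hA lA {j} => /= [|x s] h1 h2.
    by move: h1 h2; lra.
  exact: mem_last.
have j1 := hj; rewrite has_find -/j in j1; have := nth_find 0 hj; rewrite -/j.
have hb := @before_find _ 0 (fun y => a < y) A; rewrite -/j in hb.
case: j j1 hb => [|i] j1 hb hn.
  by move: hA hn; rewrite nth0; lra.
by exists i; split=> //; rewrite leNgt hb.
Qed.

Lemma isF_germ q f a l : isF q f -> 0 <= a -> 0 < l -> a + l <= 1 ->
  exists z m, [/\ 0 < m, m <= l &
    forall t, 0 <= t <= m -> f (a + t) = f a + (q%:R : rat) ^ z * t].
Proof.
case=> A [B [_ [[hA lA] _] _ H]] a0 l0 al.
have [||i [hi h1 h2]] := @find_piece A a; [by rewrite hA | by rewrite lA; lra |].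
have [h3 [z hz] hf] := H i hi.
set a' := nth 0 A i.+1 in h2 h3 hz hf.
exists z, (Num.min l (a' - a)); split.
- by rewrite lt_min l0 subr_gt0.
- by rewrite ge_min lexx.
- move=> t /andP [t0]; rewrite le_min => /andP [t1 t2].
  rewrite -hz !hf; first by ring.
    by apply/andP; split; lra.
  by apply/andP; split; lra.
Qed.

(** Compare right slopes in g = f o w at the left end of [I]: those of g and f are powers p^(kz) and
    p^(ky), that of w is p^(d-e), so kz = ky + d - e. *)
Lemma depths_congr p k f g w I J d e : (1 < p)%N ->
  isF (p ^ k) f -> isF (p ^ k) g ->
  (forall x, 0 <= x <= 1 -> g x = f (w x)) -> affine w I J ->
  [/\ 0 <= I.1, 0 < I.2 & I.1 + I.2 <= 1] ->
  [/\ 0 <= J.1, 0 < J.2 & J.1 + J.2 <= 1] ->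
  I.2 = p%:R ^- d -> J.2 = p%:R ^- e -> d = e %[mod k].
Proof.
move=> p1 hf hg E hw [I1 I2 I3] [J1 J2 J3] hI hJ.
have [z [m [m0 ml gm]]] := isF_germ hg I1 I2 I3.
have [y [n [n0 nl fn]]] := isF_germ hf J1 J2 J3.
(* Small enough for both germs to be valid at parameter [t]. *)
pose t := Num.min (m / I.2) (n / J.2).
have t0 : 0 < t by rewrite lt_min !divr_gt0.
have tm : I.2 * t <= m by rewrite mulrC -ler_pdivlMr // ge_min lexx.
have tn : J.2 * t <= n by rewrite mulrC -ler_pdivlMr // ge_min lexx orbT.
have It0 : 0 < I.2 * t by rewrite mulr_gt0.
have Jt0 : 0 < J.2 * t by rewrite mulr_gt0.
have t1 : t <= 1 by rewrite -(ler_pM2l I2) mulr1; lra.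
have E0 : g I.1 = f J.1.
  rewrite E; last by apply/andP; split; lra.
  by have := hw 0; rewrite !mulr0 !addr0 => -> //; rewrite lexx ler01.
have Et : g (I.1 + I.2 * t) = f (J.1 + J.2 * t).
  rewrite E; last by apply/andP; split; lra.
  by rewrite hw //; apply/andP; split; lra.
have p0' : p%:R != 0 :> rat by apply: natr_neq0; exact: ltnW.
have {}Et : (p%:R : rat) ^ (k%:Z * z - d%:Z) = p%:R ^ (k%:Z * y - e%:Z).
  move: Et; rewrite gm ?fn ?(ltW It0) ?(ltW Jt0) // E0 => /addrI.
  rewrite !mulrA => /(mulIf (lt0r_neq0 t0)); rewrite hI hJ.
  by rewrite natrX !exprnP !invr_expz !exprz_exp -!expfzDr.
have Ez : k%:Z * z - d%:Z = k%:Z * y - e%:Z.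
  move: Et; apply: ieexprIz; first by rewrite ltr0n ltnW.
  by rewrite -[1]/(1%:R) eqr_nat gtn_eqF.
have {}Ez : d%:Z = (z - y) * k%:Z + e%:Z.
  by rewrite mulrBl ![_ * k%:Z]mulrC; move: Ez => /(canLR (subrK _)) Ez; clear -Ez; lia.
have : (d%:Z %% k%:Z)%Z = (e%:Z %% k%:Z)%Z by rewrite Ez modzMDl.
by rewrite !modz_nat => -[].
Qed.

Lemma treepart_bounds q P X : (0 < q)%N -> treepart q P -> X \in P ->
  [/\ 0 <= X.1, 0 < X.2 & X.1 + X.2 <= 1].
Proof. by move=> q0 /(chain_treepart q0); exact: chain_bounds. Qed.

Lemma pwaffine_in f P Q x : pwaffine f P Q -> x \in zip P Q ->
  affine f x.1 x.2.
Proof.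
elim: P Q => [|I P IH] [|J Q] //= [h hP]; rewrite inE => /orP [/eqP ->|] //.
exact: IH.
Qed.

Lemma mem_zip (S T : eqType) (s : seq S) (t : seq T) x :
  x \in zip s t -> x.1 \in s /\ x.2 \in t.
Proof.
elim: s t => [|a s IH] [|b t] //=; rewrite !inE => /orP [/eqP ->|/IH [h1 h2]].
  by rewrite !eqxx.
by rewrite h1 h2 !orbT.
Qed.

Lemma treepart_depth q P X : treepart q P -> X \in P -> exists d, X.2 = q%:R ^- d.
Proof.
by case=> t <-; apply: (@leaves_depth q t unit_ival 0); rewrite expr0 invr1.
Qed.

Local Close Scope ring_scope.

(* The inclusion F(p^k) -> F(p) is a quasi-isometric embedding of word
   metrics: d_p <= C d_{p^k} + K and d_{p^k} <= C d_p + K. *)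
Theorem theorem7 (p k : nat) (hp : (2 <= p)%N) (hk : (1 <= k)%N) :
  exists C K : nat, (1 <= C)%N /\
    forall f g : rat -> rat, isF (p ^ k) f -> isF (p ^ k) g ->
    forall n : nat,
      (wdist_le (p ^ k) f g n -> wdist_le p f g (C * n + K)) /\
      (wdist_le p f g n -> wdist_le (p ^ k) f g (C * n + K)).
Proof.
have p0 : (0 < p)%N by lia.
set q := (p ^ k)%N.
have q1 : (1 < q)%N by rewrite -(exp1n k) ltn_exp2r.
(* A word of length n over p has a tree pair of at most 3pn + 1 leaves; expansion multiplies this by
   q and the return to words by 8, giving 24pqn + 8q with p <= q. The other direction gives only
   24qn + 8. *)
exists (24 * q * q), (8 * q); split; first by lia.
move=> f g hf hg n; split=> -[w [hn hw E]].
  have [P [Q [hP hQ h hs]]] := word_treepart (ltnW q1) hw.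
  have [v [hv hvs Ev]] :=
    word_length_treepart hp (treepart_of_pow p0 hP) (treepart_of_pow p0 hQ) h.
  exists v; split=> //; last by move=> x hx; rewrite E // Ev.
  nia.
have [P [Q [hP hQ h hs]]] := word_treepart p0 hw.
(* Since [f] and [g] have slopes that are powers of p^k, matching leaves of the tree pair of [w]
   have depths congruent modulo k. *)
have [|L [hL hLs LP LQ]] := @align_depths p k P Q p0 hk (pwaffine_size h).
  move=> x hx; have [h1 h2] := mem_zip hx.
  have [d hd] := treepart_depth hP h1; have [e he] := treepart_depth hQ h2.
  exists d, e; split=> //.
  exact: (depths_congr hp hf hg E (pwaffine_in h hx) (treepart_bounds p0 hP h1)
           (treepart_bounds p0 hQ h2) hd he).
have hLQ : size L = size Q by rewrite hL (pwaffine_size h).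
have [v [hv hvs Ev]] := word_length_treepart q1
  (treepart_pow hp hk (treepart_refine hP hL) LP)
  (treepart_pow hp hk (treepart_refine hQ hLQ) LQ) (pwaffine_refine p hL h).
exists v; split=> //; last by move=> x hx; rewrite E // Ev.
rewrite size_refine // -/q in hvs hLs.
have pq : (p <= q)%N by rewrite -{1}(expn1 p) leq_pexp2l.
have hpw : (q * (p * size w) <= q * (q * n))%N by rewrite leq_mul // leq_mul.
have hq : (q * size P <= q * (3 * p * size w + 1))%N by rewrite leq_mul.
apply: leq_trans hvs _; move: (leq_trans hLs hq) hpw; clear; nia.
Qed.
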